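(* The assignments $X\mapsto\beta X$ and $f\mapsto\beta f$ form a faithful covariant functor from the category of commutative monoids to the category of left topological monoids.
   Context: $\mathcal{P}(X)$ denotes the power set ring of $X$: the set of all subsets of $X$ with addition $A+B=(A\cup B)\setminus(A\cap B)$ and multiplication $A\cdot B=A\cap B$. $\beta X=\operatorname{Spec}\mathcal{P}(X)$ with the Zariski topology, together with the map $\eta:X\to\beta X$, $x\mapsto\mathfrak{m}_x=\mathcal{P}(X\setminus\{x\})$, is the Stone–Čech compactification of the discrete space $X$: every function from $X$ to a quasi-compact Hausdorff space $Y$ factors uniquely as $\widetilde\varphi\circ\eta$ with $\widetilde\varphi:\beta X\to Y$ continuous. For a function $f:X\to Y$, $\beta f:\beta X\to\beta Y$ is the unique continuous map with $(\beta f)(\mathfrak{m}_x)=\mathfrak{m}_{f(x)}$ for all $x\in X$. A left topological semigroup is a semigroup $(S,\ast)$ whose underlying set is a topological space such that for each $p\in S$ the map $S\to S$, $x\mapsto p\ast x$, is continuous; a left topological monoid is one with an identity element. The category of left topological monoids has left topological monoids as objects and continuous morphisms of monoids as morphisms. For a commutative monoid $(X,\cdot)$ with identity $e$, $\beta X$ is regarded as a left topological monoid with the following operation: for $x\in X$ let $\phi_x:\beta X\to\beta X$ be the unique continuous map with $\phi_x(\mathfrak{m}_y)=\mathfrak{m}_{x\cdot y}$ for all $y\in X$; for $M\in\beta X$ let $\theta_M:\beta X\to\beta X$ be the unique continuous map with $\theta_M(\mathfrak{m}_x)=\phi_x(M)$ for all $x\in X$; and put $M\ast N=\theta_M(N)$.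 Its identity is $\mathfrak{m}_e$. *)

(* Defs.v *)
From HB Require Import structures.
From mathcomp Require Import all_boot all_algebra.
From mathcomp Require Import all_classical topology.

Set Implicit Arguments.
Unset Strict Implicit.
Unset Printing Implicit Defensive.

Import GRing.Theory.

Local Open Scope classical_set_scope.

Section Spectrum.
Local Open Scope ring_scope.

(* [comPzRingType] rather than [comNzRingType]: the zero ring is allowed (its
   spectrum is empty), because the power set ring of the empty set is zero. *)
Definition prime_ideal (R : comPzRingType) (I : set R) : Prop :=
  [/\ I 0,
      forall a b, I a -> I b -> I (a + b),
      forall a b, I b -> I (a * b),
      ~ I 1 &
      forall a b, I (a * b) -> I a \/ I b].

Record spec (R : comPzRingType) := Spec {
  spec_ideal :> R -> Prop;
  specP : prime_ideal spec_ideal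
}.

Variable R : comPzRingType.
Implicit Types (p q : spec R) (E : set R).

Lemma spec_eq p q : (forall a, p a <-> q a) -> p = q.
Proof.
case: p q => [I pI] [J pJ] /= IJ.
have {}IJ : I = J by apply/seteqP; split=> a /IJ.
by move: pI; rewrite IJ => pI; congr Spec; exact: Prop_irrelevance.
Qed.

HB.instance Definition _ := gen_eqMixin (spec R).
HB.instance Definition _ := gen_choiceMixin (spec R).

Definition vanishing_locus E : set (spec R) := [set p | E `<=` p].

Definition zariski_open (U : set (spec R)) : Prop :=
  exists E, U = ~` vanishing_locus E.

Lemma zariski_openT : zariski_open setT.
Proof.
exists [set 1]; apply/seteqP; split=> // p _ /= H.
by have [_ _ _ + _] := specP p; apply; exact: H.
Qed.

Lemma zariski_openI : setI_closed zariski_open.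
Proof.
move=> _ _ [E ->] [F ->].
exists [set c | exists a b, [/\ E a, F b & c = a * b]].
apply/seteqP; split=> p /=.
  move=> [/existsNP [a /not_implyP [Ea npa]]].
  move=> /existsNP [b /not_implyP [Fb npb]] H.
  have [_ _ _ _ pr] := specP p.
  by have [] := pr a b (H _ (ex_intro _ a (ex_intro _ b (And3 Ea Fb erefl)))).
have [_ _ pM _ _] := specP p.
move=> H; split=> K; apply: H => _ [a [b [Ea Fb ->]]].
  by rewrite mulrC; apply: pM; exact: K.
by apply: pM; exact: K.
Qed.

Lemma zariski_open_bigU (I : Type) (f : I -> set (spec R)) :
  (forall i, zariski_open (f i)) -> zariski_open (\bigcup_i f i).
Proof.
move=> /choice [E fE]; exists (\bigcup_i E i).
apply/seteqP; split=> p /=.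
  by move=> [i _]; rewrite fE /= => H K; apply: H => a Ea; apply: K; exists i.
move=> H; apply: contrapT => K; apply: H => a [i _ Ea].
apply: contrapT => npa; apply: K; exists i => //.
by rewrite fE => H; apply: npa; exact: H.
Qed.

HB.instance Definition _ := isOpenTopological.Build (spec R)
  zariski_openT zariski_openI zariski_open_bigU.

Lemma open_specE : open = zariski_open :> set_system (spec R).
Proof. by []. Qed.

Lemma open_basic a : open [set p : spec R | ~ p a].
Proof.
rewrite open_specE; exists [set a]; apply/seteqP; split=> p /= npa H; apply: npa.
  exact: H.
by move=> _ ->.
Qed.

Lemma nbhs_basic p (W : set (spec R)) :
  nbhs p W -> exists2 a, ~ p a & [set q : spec R | ~ q a] `<=` W.
Proof.
rewrite nbhsE => -[U []]; rewrite open_specE => -[E ->] /=.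
move=> /existsNP [a /not_implyP [Ea npa]] UW.
by exists a => // q nqa; apply: UW => H; apply: nqa; exact: H.
Qed.

Lemma compact_spec : compact [set: spec R].
Proof.
rewrite compact_ultra => F FU _.
pose I := [set a | F [set p : spec R | p a]].
have prI : prime_ideal I.
  split.
  - by apply: filterS filterT => p _; have [] := specP p.
  - move=> a b Fa Fb; apply: filterS (filterI Fa Fb) => p [pa pb].
    by have [_ pD _ _ _] := specP p; exact: pD.
  - move=> a b; apply: filterS => p pb.
    by have [_ _ pM _ _] := specP p; exact: pM.
  - by move=> /filter_ex [p p1]; have [_ _ _ + _] := specP p.
  - move=> a b Fab; have [Fa|Fna] := in_ultra_setVsetC [set p : spec R | p a] FU.
      by left.
    right; apply: filterS (filterI Fab Fna) => p [/= pab npa].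
    by have [_ _ _ _ pr] := specP p; have [] := pr _ _ pab.
exists (Spec prI); split=> // W /nbhs_basic [a nFa aW].
by have [//|Fna] := in_ultra_setVsetC [set p : spec R | p a] FU; exact: filterS Fna.
Qed.

End Spectrum.

Definition powerset (X : Type) : Type := set X.

Section PowersetRing.
Variable X : Type.

HB.instance Definition _ := Choice.on (powerset X).

Let powersetYN : left_inverse set0 id (@setY X).
Proof. exact: setYK. Qed.

HB.instance Definition _ := GRing.isZmodule.Build (powerset X)
  (@setYA X) (@setYC X) (@set0Y X) powersetYN.

HB.instance Definition _ := GRing.Zmodule_isComPzRing.Build (powerset X)
  (@setIA X) (@setIC X) (@setTI X) (@setIYl X).

Lemma powerset_addE (A B : powerset X) :
  (A + B)%R = (A `|` B) `\` (A `&` B).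
Proof. exact: setYE. Qed.

Lemma powerset_mulE (A B : powerset X) : (A * B)%R = A `&` B.
Proof. by []. Qed.

End PowersetRing.

Definition beta (X : Type) : Type := spec (powerset X).

HB.instance Definition _ (X : Type) :=
  Topological.copy (beta X) (spec (powerset X)).

Section StoneCech.
Variable X : Type.
Implicit Types (M N : beta X) (A B : powerset X).

Lemma principal_prime (x : X) : prime_ideal [set A : powerset X | A `<=` ~` [set x]].
Proof.
split.
- by move=> y [].
- move=> A B HA HB y; rewrite powerset_addE => -[[/HA|/HB]//].
- by move=> A B HB y [_ /HB].
- by move=> /(_ x I) /(_ erefl).
- move=> A B HAB; have [Ax|nAx] := pselect (A x); last first.
    by left=> y Ay yx; apply: nAx; rewrite -yx.
  by right=> y By yx; move: By; rewrite yx => Bx; apply: (HAB x).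
Qed.

Definition beta_eta (x : X) : beta X := Spec (principal_prime x).

Lemma beta_etaE x A : beta_eta x A <-> ~ A x.
Proof.
by split=> [H Ax|nAx y Ay /= yx]; [exact: (H x Ax)|apply: nAx; rewrite -yx].
Qed.

Lemma beta_setC M A : M (~` A) <-> ~ M A.
Proof.
have [M0 MD MM M1 pr] := specP M; split=> [MCA MA|nMA].
  apply: M1; have -> : (1 = A + ~` A :> powerset X)%R := esym (setYCT A).
  exact: MD.
by have [] : M A \/ M (~` A) by apply: pr; rewrite powerset_mulE setICr.
Qed.

Lemma beta_sub M A B : A `<=` B -> M B -> M A.
Proof.
move=> AB MB; have [_ _ MM _ _] := specP M.
by rewrite -(setIidl AB); exact: (MM A B).
Qed.

(* Points of [beta X] are ideals; the ultrafilter of a point is the complement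
   of its ideal. *)
Definition beta_filter M : set_system X := [set A | ~ M A].

Lemma beta_ultra M : UltraFilter (beta_filter M).
Proof.
have [M0 MD MM M1 pr] := specP M.
have FF : ProperFilter (beta_filter M).
  split; first by move=> H; exact: H M0.
  split=> [|A B nMA nMB MAB|A B AB nMA MB].
  - exact: M1.
  - by have [] := pr _ _ MAB.
  - by apply: nMA; exact: beta_sub MB.
split=> // G GF MG; apply/seteqP; split=> // A GA MA.
have GCA : G (~` A) by apply: MG; rewrite /beta_filter /= beta_setC; apply.
by have [x []] := filter_ex (filterI GA GCA).
Qed.

Lemma hausdorff_beta : hausdorff_space (beta X).
Proof.
move=> M N MN; apply: spec_eq => A.
suff H (P Q : beta X) B : cluster (nbhs P) Q -> P B -> Q B.
  split; first exact: H.
  by apply: H => U V NU MV; rewrite setIC; exact: MN.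
move=> PQ PB; apply: contrapT => nQB.
have nPB : ~ P (~` B) by rewrite beta_setC; apply.
have [] := PQ [set p : beta X | ~ p (~` B)] [set p : beta X | ~ p B].
- by apply: open_nbhs_nbhs; split=> //; exact: open_basic.
- by apply: open_nbhs_nbhs; split=> //; exact: open_basic.
by move=> p [/=]; rewrite beta_setC.
Qed.

Lemma compact_beta : compact [set: beta X].
Proof. exact: compact_spec. Qed.

Lemma dense_beta_eta M (W : set (beta X)) : nbhs M W -> exists x, W (beta_eta x).
Proof.
move=> /nbhs_basic [A nMA AW].
have [x Ax] : A !=set0.
  apply/set0P/eqP => A0; apply: nMA; rewrite A0.
  by have [] := specP M.
by exists x; apply: AW => /beta_etaE; apply.
Qed.

Lemma beta_continuous_eq (Y : topologicalType) (g h : beta X -> Y) :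
  hausdorff_space Y -> continuous g -> continuous h ->
  (forall x, g (beta_eta x) = h (beta_eta x)) -> g = h.
Proof.
move=> hY cg ch gh; apply/funext => M; apply: hY => U V gU hV.
have [x [Ux Vx]] : exists x, (g @^-1` U `&` h @^-1` V) (beta_eta x).
  by apply: (@dense_beta_eta M); apply: filterI; [exact: cg|exact: ch].
by exists (g (beta_eta x)); split=> //; rewrite gh.
Qed.

Theorem stone_cech (Y : topologicalType) (phi : X -> Y) :
  compact [set: Y] -> hausdorff_space Y ->
  exists! g : beta X -> Y, continuous g /\ forall x, g (beta_eta x) = phi x.
Proof.
move=> cY hY.
have cvg_ex M : exists y : Y, phi @ beta_filter M --> y.
  have UM := beta_ultra M.
  have : UltraFilter (phi @ beta_filter M).
    split=> [|G GF FG]; first exact: fmap_proper_filter.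
    apply/seteqP; split=> // A GA.
    have [//|FA] := in_ultra_setVsetC (phi @^-1` A) UM.
    have GCA : G (~` A) by exact: FG.
    by have [x []] := filter_ex (filterI GA GCA).
  move=> UF; have := cY; rewrite compact_ultra => /(_ _ UF filterT) [y [_ Fy]].
  by exists y.
have [g gM] := choice cvg_ex.
have cg : continuous g.
  move=> M W gMW.
  have [C gC CW] := compact_regular hY cY filterT gMW.
  have nMC : ~ M (phi @^-1` C) := gM M C gC.
  apply: (@filterS _ _ _ [set N : beta X | ~ N (phi @^-1` C)]); last first.
    by apply: open_nbhs_nbhs; split=> //; exact: open_basic.
  move=> N nNC; apply: CW => V gV.
  have FN := beta_ultra N.
  have FV : beta_filter N (phi @^-1` V) := gM N V gV.
  have [x [Cx Vx]] := filter_ex (filterI (nNC : beta_filter N _) FV).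
  by exists (phi x).
have geta x : g (beta_eta x) = phi x.
  apply: hY => U V gU fV; exists (phi x).
  have nU : ~ beta_eta x (phi @^-1` U) := gM (beta_eta x) U gU.
  split; last exact: nbhs_singleton.
  by apply: contrapT => nUx; apply/nU/beta_etaE.
exists g; split=> // h [ch heta].
by apply: beta_continuous_eq => // x; rewrite geta heta.
Qed.

Definition stone_cech_ext (Y : topologicalType) (cY : compact [set: Y])
    (hY : hausdorff_space Y) (phi : X -> Y) : beta X -> Y :=
  sval (cid (stone_cech phi cY hY)).

Lemma stone_cech_ext_continuous (Y : topologicalType) (cY : compact [set: Y])
    (hY : hausdorff_space Y) (phi : X -> Y) :
  continuous (stone_cech_ext cY hY phi).
Proof. exact: (svalP (cid (stone_cech phi cY hY))).1.1. Qed.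

Lemma stone_cech_ext_eta (Y : topologicalType) (cY : compact [set: Y])
    (hY : hausdorff_space Y) (phi : X -> Y) (x : X) :
  stone_cech_ext cY hY phi (beta_eta x) = phi x.
Proof. exact: (svalP (cid (stone_cech phi cY hY))).1.2. Qed.

End StoneCech.

Arguments beta_eta {X}.

Definition beta_ext (X Y : Type) (phi : X -> beta Y) : beta X -> beta Y :=
  stone_cech_ext (@compact_beta Y) (@hausdorff_beta Y) phi.

Lemma beta_ext_continuous (X Y : Type) (phi : X -> beta Y) :
  continuous (beta_ext phi).
Proof. exact: stone_cech_ext_continuous. Qed.

Lemma beta_ext_eta (X Y : Type) (phi : X -> beta Y) (x : X) :
  beta_ext phi (beta_eta x) = phi x.
Proof. exact: stone_cech_ext_eta. Qed.

Lemma beta_ext_unique (X Y : Type) (phi : X -> beta Y) (g : beta X -> beta Y) :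
  continuous g -> (forall x, g (beta_eta x) = phi x) -> g = beta_ext phi.
Proof.
move=> cg gphi; apply: beta_continuous_eq => //; first exact: hausdorff_beta.
  exact: beta_ext_continuous.
by move=> x; rewrite beta_ext_eta.
Qed.

Definition beta_map (X Y : Type) (f : X -> Y) : beta X -> beta Y :=
  beta_ext (fun x => beta_eta (f x)).

(* [monoidType] and [topologicalType] carry a choice structure besides the
   mathematical one; classically every type has one and morphisms ignore it, so
   the categories below are equivalent to the usual ones. *)
HB.mixin Record Monoid_isCommutative X & Monoid X := {
  mulgC : forall x y : X, (x * y = y * x)%g
}.

#[short(type="comMonoidType")]
HB.structure Definition ComMonoid := {X of Monoid_isCommutative X & Monoid X}.

HB.mixin Record isLeftTopological S & Topological S & Magma S := {
  mulg_continuous : forall p : S, continuous (fun x : S => (p * x)%g)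
}.

#[short(type="leftTopologicalMonoidType")]
HB.structure Definition LeftTopologicalMonoid :=
  {S of isLeftTopological S & Topological S & Monoid S}.

#[short(type="continuousMonoidMorphism")]
HB.structure Definition ContinuousMonoidMorphism
    (S T : leftTopologicalMonoidType) :=
  {f of @isContinuous S T f & @UMagmaMorphism S T f}.

Section BetaMonoid.
Variable X : comMonoidType.
Local Open Scope group_scope.
Implicit Types (x y : X) (L M N : beta X).

Definition beta_phi x : beta X -> beta X := beta_ext (fun y => beta_eta (x * y)).

Definition beta_theta M : beta X -> beta X := beta_ext (fun x => beta_phi x M).

Definition beta_mul M N : beta X := beta_theta M N.

Definition beta_one : beta X := beta_eta 1.

Let ext_eq := fun g h => @beta_continuous_eq X (beta X) g h (@hausdorff_beta X).

Let phi_cts x : continuous (beta_phi x).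
Proof. exact: beta_ext_continuous. Qed.

Let theta_cts M : continuous (beta_theta M).
Proof. exact: beta_ext_continuous. Qed.

Let comp_cts (f g : beta X -> beta X) :
  continuous f -> continuous g -> continuous (f \o g).
Proof. by move=> cf cg M; apply: continuous_comp; [exact: cg|exact: cf]. Qed.

Lemma beta_phi_eta x y : beta_phi x (beta_eta y) = beta_eta (x * y).
Proof. exact: beta_ext_eta. Qed.

Lemma beta_theta_eta M x : beta_theta M (beta_eta x) = beta_phi x M.
Proof. exact: beta_ext_eta. Qed.

Let phi_comp x y L : beta_phi x (beta_phi y L) = beta_phi (x * y) L.
Proof.
rewrite -[LHS]/((beta_phi x \o beta_phi y) L); congr (_ L).
apply: ext_eq => [||z]; [exact: comp_cts|exact: phi_cts|].
by rewrite /= !beta_phi_eta mulgA.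
Qed.

Let phi_theta x L M : beta_phi x (beta_theta L M) = beta_theta L (beta_phi x M).
Proof.
rewrite -[LHS]/((beta_phi x \o beta_theta L) M).
rewrite -[RHS]/((beta_theta L \o beta_phi x) M); congr (_ M).
apply: ext_eq => [||y]; [exact: comp_cts|exact: comp_cts|].
by rewrite /= beta_phi_eta !beta_theta_eta phi_comp.
Qed.

Lemma beta_mulA : associative beta_mul.
Proof.
move=> L M N; rewrite /beta_mul.
rewrite -[LHS]/((beta_theta L \o beta_theta M) N); congr (_ N).
apply: ext_eq => [||x]; [exact: comp_cts|exact: theta_cts|].
by rewrite /= !beta_theta_eta phi_theta.
Qed.

Lemma beta_mul1 : left_id beta_one beta_mul.
Proof.
move=> N; rewrite /beta_mul -[RHS]/(id N); congr (_ N).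
apply: ext_eq => [||x]; [exact: theta_cts|by move=> ?|].
by rewrite beta_theta_eta beta_phi_eta mulg1.
Qed.

Lemma beta_mulr1 : right_id beta_one beta_mul.
Proof.
move=> M; rewrite /beta_mul beta_theta_eta -[RHS]/(id M); congr (_ M).
apply: ext_eq => [||x]; [exact: phi_cts|by move=> ?|].
by rewrite beta_phi_eta mul1g.
Qed.

HB.instance Definition _ :=
  isMonoid.Build (beta X) beta_mulA beta_mul1 beta_mulr1.

HB.instance Definition _ := isLeftTopological.Build (beta X) theta_cts.

End BetaMonoid.

Record category := Category {
  object :> Type;
  hom : object -> object -> Type;
  cat_id : forall A, hom A A;
  cat_comp : forall A B C, hom B C -> hom A B -> hom A C;
  cat_comp_idl : forall A B (f : hom A B), cat_comp (cat_id B) f = f;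
  cat_comp_idr : forall A B (f : hom A B), cat_comp f (cat_id A) = f;
  cat_compA : forall A B C D (h : hom C D) (g : hom B C) (f : hom A B),
    cat_comp h (cat_comp g f) = cat_comp (cat_comp h g) f
}.

Arguments hom {c}.
Arguments cat_id {c}.
Arguments cat_comp {c A B C}.

Section Functors.
Variables (C D : category) (F : C -> D).
Variable Fhom : forall A B : C, hom A B -> hom (F A) (F B).

Definition is_functor : Prop :=
  (forall A : C, Fhom (cat_id A) = cat_id (F A)) /\
  (forall (A B E : C) (g : hom B E) (f : hom A B),
     Fhom (cat_comp g f) = cat_comp (Fhom g) (Fhom f)).

Definition is_faithful : Prop :=
  forall (A B : C) (f g : hom A B), Fhom f = Fhom g -> f = g.

End Functors.

Lemma umagma_morphism_eq (G H : baseUMagmaType) (f g : UMagmaMorphism.type G H) :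
  f =1 g -> f = g.
Proof.
case: f g => [f [[f1] [fM]]] [g [[g1] [gM]]] /= /funext fg.
by subst g; rewrite (Prop_irrelevance f1 g1) (Prop_irrelevance fM gM).
Qed.

Lemma continuous_monoid_morphism_eq (S T : leftTopologicalMonoidType)
  (f g : continuousMonoidMorphism S T) : f =1 g -> f = g.
Proof.
case: f g => [f [[fc] [f1] [fM]]] [g [[gc] [g1] [gM]]] /= /funext fg; subst g.
by rewrite (Prop_irrelevance f1 g1) (Prop_irrelevance fM gM)
  (Prop_irrelevance fc gc).
Qed.

Section ComMonoidCategory.

Definition com_hom (X Y : comMonoidType) : Type := UMagmaMorphism.type X Y.

Definition com_id (X : comMonoidType) : com_hom X X := idfun.

Definition com_comp (X Y Z : comMonoidType) (g : com_hom Y Z) (f : com_hom X Y) :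
  com_hom X Z := g \o f.

Lemma com_comp_idl X Y (f : com_hom X Y) : com_comp (com_id Y) f = f.
Proof. exact: umagma_morphism_eq. Qed.

Lemma com_comp_idr X Y (f : com_hom X Y) : com_comp f (com_id X) = f.
Proof. exact: umagma_morphism_eq. Qed.

Lemma com_compA X Y Z T (h : com_hom Z T) (g : com_hom Y Z) (f : com_hom X Y) :
  com_comp h (com_comp g f) = com_comp (com_comp h g) f.
Proof. exact: umagma_morphism_eq. Qed.

Definition comMonoidCat : category :=
  Category com_comp_idl com_comp_idr com_compA.

End ComMonoidCategory.

Section LeftTopologicalMonoidCategory.

Definition ltm_hom (S T : leftTopologicalMonoidType) : Type :=
  continuousMonoidMorphism S T.

HB.instance Definition _ (S : leftTopologicalMonoidType) :=
  UMagmaMorphism.on (@idfun S).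

HB.instance Definition _ (S T U : leftTopologicalMonoidType)
    (g : ltm_hom T U) (f : ltm_hom S T) :=
  UMagmaMorphism.on (g \o f).

Definition ltm_id (S : leftTopologicalMonoidType) : ltm_hom S S := idfun.

Definition ltm_comp (S T U : leftTopologicalMonoidType)
  (g : ltm_hom T U) (f : ltm_hom S T) : ltm_hom S U := g \o f.

Lemma ltm_comp_idl S T (f : ltm_hom S T) : ltm_comp (ltm_id T) f = f.
Proof. exact: continuous_monoid_morphism_eq. Qed.

Lemma ltm_comp_idr S T (f : ltm_hom S T) : ltm_comp f (ltm_id S) = f.
Proof. exact: continuous_monoid_morphism_eq. Qed.

Lemma ltm_compA S T U V (h : ltm_hom U V) (g : ltm_hom T U) (f : ltm_hom S T) :
  ltm_comp h (ltm_comp g f) = ltm_comp (ltm_comp h g) f.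
Proof. exact: continuous_monoid_morphism_eq. Qed.

Definition leftTopologicalMonoidCat : category :=
  Category ltm_comp_idl ltm_comp_idr ltm_compA.

End LeftTopologicalMonoidCategory.

Definition beta_object (X : comMonoidCat) : leftTopologicalMonoidCat :=
  beta (X : comMonoidType) : leftTopologicalMonoidType.

(* Main.v *)
Require Import Defs.
From HB Require Import structures.
From mathcomp Require Import all_boot.
From mathcomp Require Import all_classical topology.

(** Two continuous maps between Stone-Čech compactifications of discrete spaces
agree as soon as they agree on principal points, because these are dense and
the target is Hausdorff.  Every functor law reduces to a computation on
principal points in this way, as does the compatibility of [beta_map f] with
the product.  The product is continuous only in its right-hand argument, so
the identity f (M * N) = f M * f N takes two reductions: the first replaces N
by a principal point m_x, for which M * m_x is [beta_phi x M]; this is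
continuous in M, so the second replaces M by a principal point
([beta_map_phi], [beta_map_mul]).  Faithfulness holds because [beta_map f]
restricts to f on principal points and distinct elements have distinct
principal points ([beta_eta_inj]). *)

Set Implicit Arguments.
Unset Strict Implicit.
Unset Printing Implicit Defensive.

(** The singleton of [x] separates: it belongs to the ideal of [y] exactly when
[y] differs from [x]. *)
Lemma beta_eta_inj (X : Type) : injective (@beta_eta X).
Proof.
move=> x y xy; apply: contrapT => nxy.
have /beta_etaE : ~ [set x]%classic y by move=> /= yx; apply: nxy.
by rewrite -xy beta_etaE; apply.
Qed.

Section BetaMap.
Variables (X Y Z : Type).

Lemma beta_map_continuous (f : X -> Y) : continuous (beta_map f).
Proof. exact: beta_ext_continuous. Qed.

Lemma beta_map_eta (f : X -> Y) x : beta_map f (beta_eta x) = beta_eta (f x).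
Proof. exact: beta_ext_eta. Qed.

Lemma beta_map_id : beta_map (@idfun X) = idfun.
Proof. by apply/esym/beta_ext_unique => // M. Qed.

Lemma continuous_beta_comp (g : beta Y -> beta Z) (f : beta X -> beta Y) :
  continuous g -> continuous f -> continuous (g \o f).
Proof. by move=> cg cf M; apply: continuous_comp; [exact: cf|exact: cg]. Qed.

End BetaMap.

Lemma beta_map_comp (X Y Z : Type) (g : Y -> Z) (f : X -> Y) :
  beta_map (g \o f) = beta_map g \o beta_map f.
Proof.
apply/esym/beta_ext_unique => [|x]; last by rewrite /= !beta_map_eta.
by apply: continuous_beta_comp; exact: beta_map_continuous.
Qed.

Section BetaMorphism.
Variables (X Y : comMonoidType) (f : com_hom X Y).
Local Open Scope group_scope.

Lemma beta_map_phi x (M : beta X) :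
  beta_map f (beta_phi x M) = beta_phi (f x) (beta_map f M).
Proof.
rewrite -[LHS]/((beta_map f \o beta_phi x) M).
rewrite -[RHS]/((beta_phi (f x) \o beta_map f) M); congr (_ M).
apply: beta_continuous_eq => [|||y]; first exact: hausdorff_beta.
- by apply: continuous_beta_comp; exact: beta_ext_continuous.
- by apply: continuous_beta_comp; exact: beta_ext_continuous.
by rewrite /= beta_map_eta !beta_phi_eta beta_map_eta gmulfM.
Qed.

Lemma beta_map_mul : {morph beta_map f : M N / M * N}.
Proof.
move=> M N.
rewrite -[LHS]/((beta_map f \o beta_theta M) N).
rewrite -[RHS]/((beta_theta (beta_map f M) \o beta_map f) N); congr (_ N).
apply: beta_continuous_eq => [|||x]; first exact: hausdorff_beta.
- by apply: continuous_beta_comp; exact: beta_ext_continuous.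
- by apply: continuous_beta_comp; exact: beta_ext_continuous.
by rewrite /= beta_map_eta !beta_theta_eta beta_map_phi.
Qed.

Lemma beta_map_one : beta_map f 1 = 1.
Proof. by rewrite [LHS]beta_map_eta gmulf1. Qed.

(** An alias of [beta_map f] that keeps [f] as a morphism, so that the
instances below can be found from its head constant. *)
Definition beta_morphism : beta X -> beta Y := beta_map f.

HB.instance Definition _ :=
  isMultiplicative.Build (beta X) (beta Y) beta_morphism beta_map_mul.

HB.instance Definition _ :=
  Multiplicative_isUMagmaMorphism.Build (beta X) (beta Y) beta_morphism
    beta_map_one.

HB.instance Definition _ :=
  isContinuous.Build (beta X) (beta Y) beta_morphism (@beta_map_continuous X Y f).

End BetaMorphism.

Theorem theorem9p3 :
  exists beta_hom : forall X Y : comMonoidCat,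
      hom X Y -> hom (beta_object X) (beta_object Y),
    [/\ forall (X Y : comMonoidType) (f : com_hom X Y) (M : beta X),
          (beta_hom X Y f : ltm_hom (beta X) (beta Y)) M = beta_map f M,
        is_functor beta_hom &
        is_faithful beta_hom].
Proof.
exists (fun (X Y : comMonoidType) (f : com_hom X Y) =>
  beta_morphism f : ltm_hom (beta X) (beta Y)).
split=> //; first split.
- move=> X; apply: continuous_monoid_morphism_eq => M /=.
  by rewrite /beta_morphism beta_map_id.
- move=> X Y Z g f; apply: continuous_monoid_morphism_eq => M /=.
  by rewrite /beta_morphism beta_map_comp.
move=> X Y f g fg; apply: umagma_morphism_eq => x; apply: beta_eta_inj.
rewrite -!beta_map_eta.
exact: (congr1 (fun h : ltm_hom (beta X) (beta Y) => h (beta_eta x)) fg).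
Qed.
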